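(* Let $\lambda\in(0,1)$ and $T\in\mathbb{B}(\mathcal{H})$. Then $T$ is invertible if and only if $P_{\lambda}(T)$ is invertible and the range $\mathcal{R}(T)$ is closed.
   Context: $\mathbb{B}(\mathcal{H})$ denotes the bounded linear operators on a complex Hilbert space $\mathcal{H}$. Every $T\in\mathbb{B}(\mathcal{H})$ has a unique polar decomposition $T=U|T|$, where $|T|=(T^{*}T)^{1/2}$ and $U$ is a partial isometry with $\mathcal{N}(U)=\mathcal{N}(T)$ ($\mathcal{N}$ = null space). The Duggal transform is $T^{D}=|T|U$, the Aluthge transform is $\Delta(T)=|T|^{1/2}U|T|^{1/2}$, and for $\lambda\in[0,1]$ the power mean transform is $P_{\lambda}(T)=(1-\lambda)^2T+\lambda^2T^{D}+2\lambda(1-\lambda)\Delta(T)$. *)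

(* Defs.v *)
From HB Require Import structures.
From mathcomp Require Import all_boot all_order all_algebra.
From mathcomp Require Import sesquilinear complex.
From mathcomp Require Import all_classical all_reals all_analysis.

Set Implicit Arguments.
Unset Strict Implicit.
Unset Printing Implicit Defensive.

Import Order.TTheory GRing.Theory Num.Theory.
Import numFieldNormedType.Exports.

Local Open Scope classical_set_scope.
Local Open Scope ring_scope.
Local Open Scope complex_scope.

(* The inner product is linear in its first argument. *)
HB.mixin Record CompleteNormedModule_isHilbert (R : realType) H
    & CompleteNormedModule R[i] H := {
  inner : {dot H for (@Num.conj R[i])};
  sqr_normE : forall x : H, `|x| ^+ 2 = inner x x
}.

#[short(type="hilbertType")]
HB.structure Definition Hilbert (R : realType) :=
  {H of CompleteNormedModule R[i] H & CompleteNormedModule_isHilbert R H}.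

Section Operators.
Variables (R : realType) (H : hilbertType R).
Implicit Types T S U A : H -> H.

Definition bounded_op T : Prop :=
  linear T /\ exists M : R[i], forall x, `|T x| <= M * `|x|.

Definition is_adjoint T S : Prop :=
  bounded_op S /\ forall x y, inner (T x) y = inner x (S y).

(* The order of R[i] is partial: 0 <= z means that z is real and nonnegative. *)
Definition positive_op A : Prop :=
  bounded_op A /\ forall x, 0 <= inner (A x) x.

Definition is_sqrt_op A S : Prop := positive_op S /\ S \o S = A.

Definition kernel T : set H := [set x | T x = 0].

Definition orthocomplement (A : set H) : set H :=
  [set x | forall y, A y -> inner x y = 0].

Definition partial_isometry U : Prop :=
  bounded_op U /\ forall x, orthocomplement (kernel U) x -> `|U x| = `|x|.

(* The operators below are determined uniquely by the properties that select
   them whenever T, respectively A, is bounded, respectively positive. *)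
Definition adjoint T : H -> H := get [set S | is_adjoint T S].

Definition sqrt_op A : H -> H := get [set S | is_sqrt_op A S].

Definition abs_op T : H -> H := sqrt_op (adjoint T \o T).

Definition is_polar_part T U : Prop :=
  [/\ partial_isometry U, kernel U = kernel T & T = U \o abs_op T].

Definition polar_part T : H -> H := get [set U | is_polar_part T U].

Definition duggal T : H -> H := abs_op T \o polar_part T.

Definition aluthge T : H -> H :=
  sqrt_op (abs_op T) \o polar_part T \o sqrt_op (abs_op T).

Definition power_mean (lambda : R) T : H -> H := fun x =>
  ((1 - lambda) ^+ 2)%:C *: T x + (lambda ^+ 2)%:C *: duggal T x
  + (2 * lambda * (1 - lambda))%:C *: aluthge T x.

Definition invertible_op T : Prop :=
  exists S, [/\ bounded_op S, S \o T = id & T \o S = id].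

End Operators.

(* Main.v *)
(* Write T = U A with A = |T| and S = A^(1/2), a = 1 - lambda, b = lambda. With
   X = a U S + b S U one has P_lambda(T) = a X S + b S X. If T is bounded below,
   then A is invertible and U is isometric, and Re <P x, U x> = |X x|^2 where
   Re <X x, U x> >= a <S x, x>; hence Re <P x, U x> >= k |x|^2 for some k > 0.

   If T is invertible, U is onto, so the estimate makes P bounded below with dense
   range. Conversely, P kills the kernel of T, so T is injective; as its range is
   closed, A is onto, hence bounded below by uniform boundedness, and the estimate
   holds. A vector y orthogonal to the range of T, which is that of U, is P z for
   some z, and 0 = Re <P z, U z> >= k |z|^2 gives y = 0.

   Everything is estimated through the real-valued norm and the real part of the
   inner product, which take values in a totally ordered field. *)
Require Import Defs.
From HB Require Import structures.
From mathcomp Require Import all_boot all_order all_algebra.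
From mathcomp Require Import sesquilinear complex.
From mathcomp Require Import all_classical all_reals all_analysis.
From mathcomp Require Import ring lra.
Import numFieldNormedType.Exports.
Local Open Scope classical_set_scope.
Local Open Scope ring_scope.
Import Order.TTheory GRing.Theory Num.Theory.
Local Open Scope complex_scope.

Set Implicit Arguments.
Unset Strict Implicit.
Unset Printing Implicit Defensive.

(** * Real-valued norm and real part of the inner product *)

Section RealStructure.
Variables (R : realType) (H : hilbertType R).
Implicit Types (x y z : H) (r : R) (c : R[i]).

Definition rnorm x : R := complex.Re `|x|.

Definition rdot x y : R := complex.Re (inner x y).

Lemma rnormE x : `|x| = (rnorm x)%:C.
Proof. by rewrite /rnorm RRe_real ?normr_real. Qed.

Lemma rnorm_ge0 x : 0 <= rnorm x.
Proof. by rewrite -ler0c -rnormE. Qed.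

Lemma rnorm0 : rnorm 0 = 0.
Proof. by rewrite /rnorm normr0. Qed.

Lemma rnorm_eq0 x : rnorm x = 0 -> x = 0.
Proof. by move=> h; apply/normr0_eq0; rewrite rnormE h. Qed.

Lemma rnormD x y : rnorm (x + y) <= rnorm x + rnorm y.
Proof. by rewrite -lecR rmorphD /= -!rnormE ler_normD. Qed.

Lemma rnormN x : rnorm (- x) = rnorm x.
Proof. by rewrite /rnorm normrN. Qed.

Lemma rnormBC x y : rnorm (x - y) = rnorm (y - x).
Proof. by rewrite -rnormN opprB. Qed.

Lemma rnormB_trans y x z : rnorm (x - z) <= rnorm (x - y) + rnorm (y - z).
Proof. by rewrite -(subrKA y x) rnormD. Qed.

Lemma rnormZ r x : rnorm (r%:C *: x) = `|r| * rnorm x.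
Proof.
apply: (@complexI R); rewrite -rnormE normrZ rnormE rmorphM /=; congr (_ * _).
by rewrite normc_def /= expr0n addr0 sqrtr_sqr.
Qed.

Lemma rnormZc c x : rnorm (c *: x) = complex.Re `|c| * rnorm x.
Proof.
apply: (@complexI R); rewrite -rnormE normrZ rnormE rmorphM /=.
by rewrite RRe_real ?normr_real.
Qed.

Lemma innerC x y : inner x y = conjc (inner y x).
Proof. by rewrite hermC expr0 mul1r. Qed.

Lemma innerZr c x y : inner x (c *: y) = conjc c * inner x y.
Proof. by rewrite linearZr_LR. Qed.

Lemma rdotC x y : rdot x y = rdot y x.
Proof. by rewrite /rdot innerC; case: (inner y x). Qed.

Lemma rdotDl x y z : rdot (x + y) z = rdot x z + rdot y z.
Proof. by rewrite /rdot linearDl raddfD. Qed.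

Lemma rdotDr x y z : rdot z (x + y) = rdot z x + rdot z y.
Proof. by rewrite rdotC rdotDl !(rdotC z). Qed.

Lemma rdotZl r x y : rdot (r%:C *: x) y = r * rdot x y.
Proof.
by rewrite /rdot linearZl_LR /=; case: (inner x y) => a b /=; rewrite mul0r subr0.
Qed.

Lemma rdotZr r x y : rdot x (r%:C *: y) = r * rdot x y.
Proof. by rewrite rdotC rdotZl rdotC. Qed.

Lemma rdotNl x y : rdot (- x) y = - rdot x y.
Proof. by rewrite /rdot linearNl raddfN. Qed.

Lemma rdotNr x y : rdot x (- y) = - rdot x y.
Proof. by rewrite rdotC rdotNl rdotC. Qed.

Definition rdotE := (rdotDl, rdotDr, rdotZl, rdotZr, rdotNl, rdotNr).

Lemma rdot0l x : rdot 0 x = 0.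
Proof. by rewrite /rdot linear0l. Qed.

Lemma rdotxx x : rdot x x = rnorm x ^+ 2.
Proof. by rewrite /rdot -sqr_normE rnormE -rmorphXn. Qed.

Lemma rdot_conj c x y : rdot (c *: x) y = rdot x (conjc c *: y).
Proof. by rewrite /rdot linearZl_LR innerZr conjcK. Qed.

Lemma rdot_conjr c x y : rdot x (c *: y) = rdot (conjc c *: x) y.
Proof. by rewrite rdot_conj conjcK. Qed.

Lemma rdot_ir x y : rdot x ('i%C *: y) = - rdot ('i%C *: x) y.
Proof.
rewrite rdot_conjr -rdotNl -scaleNr; congr (rdot (_ *: _) _).
by apply/eqP; rewrite eq_complex /= oppr0 !eqxx.
Qed.

Lemma rdot_ii x y : rdot ('i%C *: x) ('i%C *: y) = rdot x y.
Proof. by rewrite rdot_ir scalerA -expr2 sqr_i scaleN1r rdotNl opprK. Qed.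

(** Multiplying the first argument by ['i] turns the imaginary part into a real part, so complex
    identities follow from real ones. *)
Lemma inner_rdot x y : inner x y = (rdot x y)%:C - 'i%C * (rdot ('i%C *: x) y)%:C.
Proof.
rewrite /rdot linearZl_LR /=; case: (inner x y) => a b.
by apply/eqP; rewrite eq_complex /=; apply/andP; split; apply/eqP; ring.
Qed.

Lemma rnormB_sq x y :
  rnorm (x - y) ^+ 2 = rnorm x ^+ 2 - 2 * rdot x y + rnorm y ^+ 2.
Proof. by rewrite -!rdotxx !rdotE (rdotC y x); ring. Qed.

Lemma rdot_CS x y : rdot x y <= rnorm x * rnorm y.
Proof.
have [->|y0] := eqVneq y 0; first by rewrite rdotC rdot0l rnorm0 mulr0.
have ny : 0 < rnorm y.
  rewrite lt_neqAle rnorm_ge0 andbT eq_sym; apply/eqP => /rnorm_eq0 /eqP.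
  exact/negP.
rewrite -ler_pdivrMr //.
(* The vector is [x] minus its projection on the line through [y]; its squared norm is |x|^2 - <x,
   y>^2 / |y|^2. *)
have := sqr_ge0 (rnorm (x - (rdot x y / rnorm y ^+ 2)%:C *: y)).
rewrite rnormB_sq rdotZr rnormZ exprMn real_normK ?num_real // => h.
have {}h : (rdot x y / rnorm y) ^+ 2 <= rnorm x ^+ 2.
  rewrite -subr_ge0; apply: le_trans h _; rewrite le_eqVlt; apply/orP; left.
  by apply/eqP; field; rewrite gt_eqF.
by rewrite (le_trans (ler_norm _)) // -ler_sqr ?nnegrE ?rnorm_ge0 // real_normK ?num_real.
Qed.

Lemma rdot_CSN x y : `|rdot x y| <= rnorm x * rnorm y.
Proof. by rewrite ler_norml lerNl -rdotNl -{1}(rnormN x) !rdot_CS. Qed.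

Lemma rdot_eq0 x : (forall y, rdot y x = 0) -> x = 0.
Proof.
by move=> /(_ x); rewrite rdotxx => /eqP; rewrite sqrf_eq0 => /eqP /rnorm_eq0.
Qed.

Lemma rdot_inj x y : (forall z, rdot z x = rdot z y) -> x = y.
Proof.
move=> h; apply/eqP; rewrite -subr_eq0; apply/eqP/rdot_eq0 => z.
by rewrite rdotDr rdotNr h subrr.
Qed.

End RealStructure.

(** * Limits of approximations and orthogonal projection *)

Section Completeness.
Variables (R : realType) (H : hilbertType R).
Implicit Types (x y z : H) (r e : R).

Lemma ge0_le_eps (a : R) (C : R) : 0 <= C ->
  (forall e, 0 < e -> a <= C * e) -> a <= 0.
Proof.
move=> C0 h; rewrite leNgt; apply/negP => a0.
(* At this precision [C * e] is less than [a / 2]. *)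
have := h (a / (2 * (C + 1))) (divr_gt0 a0 (mulr_gt0 _ _)).
rewrite ltr0n ltr_wpDl // => /(_ isT isT); apply/negP; rewrite -ltNge.
rewrite mulrA ltr_pdivrMr ?mulr_gt0 ?ltr_wpDl //; nra.
Qed.

Lemma inv_succ_le e : 0 < e -> exists n, forall m, (n <= m)%N -> m.+1%:R^-1 <= e.
Proof.
move=> e0; have e1 : 0 < e^-1 by rewrite invr_gt0.
exists (Num.truncn e^-1).+1 => m nm.
rewrite -[leRHS]invrK lef_pV2 ?posrE ?ltr0n //.
have /andP[_ h] := truncn_itv (ltW e1); apply/ltW/(lt_trans h).
by rewrite ltr_nat ltnS.
Qed.

Lemma real_gt0_complex (e : R[i]) : 0 < e -> exists2 r : R, 0 < r & e = r%:C.
Proof.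
case: e => a b; rewrite ltcE /= => /andP[/eqP -> a0].
by exists a.
Qed.

(* [G e] lists admissible approximations at precision [e]; asking for nested
   precisions instead of a sequence avoids choosing representatives in each use. *)
Lemma approximation_limit (G : R -> set H) :
  (forall e, 0 < e -> exists z, G e z) ->
  (forall (e d : R) z w, 0 < e -> 0 < d -> G e z -> G d w -> rnorm (z - w) <= e + d) ->
  exists l, forall e z, 0 < e -> G e z -> rnorm (z - l) <= e.
Proof.
move=> Gex GG.
have e_ (n : nat) : 0 < n.+1%:R^-1 :> R by rewrite invr_gt0 ltr0n.
have [u Gu] := choice (fun n : nat => Gex n.+1%:R^-1 (e_ n)).
have cu : cauchy (u @ \oo).
  apply/cauchy_ballP => _ /real_gt0_complex[e e0 ->].
  have e3 : 0 < e / 3 by rewrite divr_gt0.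
  have [n hn] := inv_succ_le e3.
  rewrite near_map2; exists ([set m | (n <= m)%N], [set m | (n <= m)%N]).
    by split; exists n.
  move=> [i j] [/= ni nj]; rewrite -ball_normE /ball_ /= rnormE ltcR.
  apply: le_lt_trans (GG _ _ _ _ (e_ i) (e_ j) (Gu i) (Gu j)) _.
  by apply: le_lt_trans (lerD (hn _ ni) (hn _ nj)) _; lra.
have /cauchy_cvg/cvg_ex[l ul] := cu.
exists l => e z e0 Gez; rewrite -subr_le0.
(* One [d] pays for the precision of the chosen term of [u], the other for its distance to [l]. *)
apply: (@ge0_le_eps _ 2) => // d d0.
have [n hn] := @inv_succ_le d d0.
have /cvgrPdist_lt/(_ d%:C) := ul.
rewrite ltcR d0 => /(_ isT)[m _ hm].
have h1 : rnorm (u (maxn n m) - l) < d.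
  by rewrite rnormBC -ltcR -rnormE; exact: hm (leq_maxr n m).
have h2 := GG _ _ _ _ e0 (e_ (maxn n m)) Gez (Gu (maxn n m)).
have h3 := le_trans h2 (lerD (lexx e) (hn _ (leq_maxl n m))).
by have := rnormB_trans (u (maxn n m)) z l; lra.
Qed.

Definition adherent (V : set H) x := forall e, 0 < e -> exists2 v, V v & rnorm (v - x) <= e.

Lemma closed_adherent (V : set H) x : closed V -> adherent V x -> V x.
Proof.
move=> cV ax; apply: cV => B /nbhs_ballP[_ /= /real_gt0_complex[e e0 ->]] eB.
have e2 : 0 < e / 2 by rewrite divr_gt0.
have [v Vv vx] := ax _ e2.
exists v; split => //; apply: eB; rewrite -ball_normE /ball_ /= rnormE ltcR rnormBC.
by lra.
Qed.

(** Only real scalars occur, because projections are taken for the real inner product [rdot]. *)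
Definition real_subspace (V : set H) := [/\ V 0,
  (forall x y, V x -> V y -> V (x + y)) & (forall r x, V x -> V (r%:C *: x))].

(** The foot [p] lies in the closure of [V]: it is the limit of points of [V] that nearly minimize
    the distance to [y]. *)
Lemma orthogonal_projection (V : set H) y : real_subspace V ->
  exists2 p, adherent V p & forall v, V v -> rdot (y - p) v = 0.
Proof.
move=> [V0 VD VZ].
pose D := [set rnorm (y - v) ^+ 2 | v in V].
have infD : has_inf D.
  by split; [exists (rnorm (y - 0) ^+ 2); exists 0 | exists 0 => _ [v _ <-]; exact: sqr_ge0].
pose d := inf D.
have d_le v : V v -> d <= rnorm (y - v) ^+ 2.
  by move=> Vv; apply: ge_inf; [case: infD | exists v].
pose G e := [set z | V z /\ rnorm (y - z) ^+ 2 <= d + e ^+ 2 / 2].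
have Gex e : 0 < e -> exists z, G e z.
  move=> e0; have e2 : 0 < e ^+ 2 / 2 by rewrite divr_gt0 ?exprn_gt0.
  have [_ [v Vv <-] hv] := inf_adherent e2 infD.
  by exists v; split => //; exact/ltW.
have GG e1 e2 z w : 0 < e1 -> 0 < e2 -> G e1 z -> G e2 w -> rnorm (z - w) <= e1 + e2.
  move=> e10 e20 [Vz hz] [Vw hw].
  (* Comparison with the midpoint of [z] and [w]: by the parallelogram law, the tolerances e^2 / 2
     give |z - w|^2 <= e1^2 + e2^2. *)
  have hm := d_le _ (VZ 2^-1 _ (VD _ _ Vz Vw)).
  have e12 : 0 <= e1 + e2 by rewrite addr_ge0 // ltW.
  rewrite -ler_sqr ?nnegrE ?rnorm_ge0 //.
  move: hm hz hw; rewrite !rnormB_sq -!rdotxx !rdotE (rdotC w z); nra.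
have [p hp] := approximation_limit Gex GG.
exists p => [e e0|v Vv].
  by have [z Gz] := Gex e e0; exists z; [case: Gz | exact: hp].
have key e : 0 < e -> `|rdot (y - p) v| <= (1 + rnorm v ^+ 2 + rnorm v) * e.
  move=> e0; have [z Gz] := Gex e e0; have zp := hp _ _ e0 Gz; case: Gz => Vz hz.
  have hzp : `|rdot (z - p) v| <= e * rnorm v.
    by apply: le_trans (rdot_CSN _ _) _; rewrite ler_wpM2r ?rnorm_ge0.
  (* Near-minimality of [z] against the competitor z + t v; the choices t = e and t = -e bound <y -
     z, v> by a multiple of [e]. *)
  have step t : 2 * t * rdot (y - z) v <= e ^+ 2 / 2 + t ^+ 2 * rnorm v ^+ 2.
    have := d_le _ (VD _ _ Vz (VZ t _ Vv)).
    rewrite opprD addrA rnormB_sq rdotZr rnormZ exprMn real_normK ?num_real // => h.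
    by lra.
  have h1 := step e; have h2 := step (- e).
  have hv := sqr_ge0 (rnorm v).
  have hyz : `|rdot (y - z) v| <= (1 + rnorm v ^+ 2) * e.
    by rewrite ler_norml; apply/andP; split; nra.
  rewrite (_ : rdot (y - p) v = rdot (y - z) v + rdot (z - p) v).
    by apply: le_trans (ler_normD _ _) _; lra.
  by rewrite -rdotDl subrKA.
apply/normr0_eq0/eqP; rewrite eq_le normr_ge0 andbT.
apply: ge0_le_eps key; have := rnorm_ge0 v; nra.
Qed.

End Completeness.

(** * Bounded operators, Riesz representation, adjoints and positive operators *)

Section Operators.
Variables (R : realType) (H : hilbertType R).
Implicit Types (x y z : H) (r e M : R) (T S U A : H -> H).

Section LinearMaps.
Variable T : H -> H.
Hypothesis linT : linear T.

Lemma linear_mapD x y : T (x + y) = T x + T y.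
Proof. by have := linT 1 x y; rewrite !scale1r. Qed.

Lemma linear_map0 : T 0 = 0.
Proof. by apply: (addrI (T 0)); rewrite -linear_mapD !addr0. Qed.

Lemma linear_mapZ (c : R[i]) x : T (c *: x) = c *: T x.
Proof. by have := linT c x 0; rewrite linear_map0 !addr0. Qed.

Lemma linear_mapN x : T (- x) = - T x.
Proof. by rewrite -scaleN1r linear_mapZ scaleN1r. Qed.

Lemma linear_mapB x y : T (x - y) = T x - T y.
Proof. by rewrite linear_mapD linear_mapN. Qed.

End LinearMaps.

Lemma bounded_opP T : bounded_op T <->
  linear T /\ exists2 M, 0 <= M & forall x, rnorm (T x) <= M * rnorm x.
Proof.
split=> -[linT [M]].
  (* A complex inequality contains the inequality of real parts, which leaves the bound [a]; the
     absolute value makes it nonnegative. *)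
  case: M => a b hM; split => //; exists `|a| => // x.
  have := hM x; rewrite !rnormE lecE /= => /andP[_]; rewrite mulr0 subr0 => /le_trans; apply.
  by rewrite ler_wpM2r ?rnorm_ge0 // ler_norm.
move=> M0 hM; split=> //; exists M%:C => x.
by rewrite !rnormE -rmorphM /= lecR.
Qed.

Lemma linear_comp S T : linear S -> linear T -> linear (S \o T).
Proof. by move=> linS linT c x y /=; rewrite linT linS. Qed.

Lemma bounded_op_comp S T : bounded_op S -> bounded_op T -> bounded_op (S \o T).
Proof.
move=> /bounded_opP[linS [M M0 hM]] /bounded_opP[linT [L L0 hL]].
apply/bounded_opP; split; first exact: linear_comp.
exists (M * L) => [|x]; first exact: mulr_ge0.
by apply: le_trans (hM _) _; rewrite -mulrA ler_wpM2l.
Qed.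

Lemma bounded_opD S T : bounded_op S -> bounded_op T -> bounded_op (fun x => S x + T x).
Proof.
move=> /bounded_opP[linS [M M0 hM]] /bounded_opP[linT [L L0 hL]].
apply/bounded_opP; split=> [c x y|]; first by rewrite linS linT scalerDr addrACA.
exists (M + L) => [|x]; first exact: addr_ge0.
by rewrite mulrDl (le_trans (rnormD _ _)) // lerD.
Qed.

Lemma bounded_opZ r T : bounded_op T -> bounded_op (fun x => r%:C *: T x).
Proof.
move=> /bounded_opP[linT [M M0 hM]].
apply/bounded_opP; split=> [c x y|].
  by rewrite linT scalerDr !scalerA mulrC.
exists (`|r| * M) => [|x]; first exact: mulr_ge0.
by rewrite rnormZ -mulrA ler_wpM2l.
Qed.

(** A vector orthogonal to the kernel of [f] represents [f] up to a scalar. It is y - p, where f y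
    <> 0 and [p] is the projection of [y] on the kernel; f p = 0 by continuity. *)
Lemma riesz_representation (f : H -> R) M :
  {morph f : x y / x + y} -> (forall r x, f (r%:C *: x) = r * f x) ->
  (forall x, `|f x| <= M * rnorm x) -> exists z, forall x, f x = rdot x z.
Proof.
move=> fD fZ fM.
have [f0|/existsNP[y fy]] := pselect (forall x, f x = 0).
  by exists 0 => x; rewrite f0 rdotC rdot0l.
have fN x : f (- x) = - f x.
  have -> : - x = (-1)%:C *: x by rewrite rmorphN rmorph1 scaleN1r.
  by rewrite fZ mulN1r.
have kerV : real_subspace [set x | f x = 0].
  split=> [|x z /= fx fz|r x /= fx]; last by rewrite fZ fx mulr0.
  - by rewrite /= -(scale0r 0) -(rmorph0 (real_complex R)) fZ mul0r.
  - by rewrite fD fx fz addr0.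
have [p ap pV] := orthogonal_projection y kerV.
have fp : f p = 0.
  apply/normr0_eq0/eqP; rewrite eq_le normr_ge0 andbT.
  apply: (@ge0_le_eps _ _ `|M|) => // e e0.
  have [v fv vp] := ap _ e0.
  have <- : f (p - v) = f p by rewrite fD fN fv subr0.
  apply: le_trans (fM _) _; rewrite rnormBC.
  apply: le_trans (ler_wpM2r (rnorm_ge0 _) (ler_norm M)) _.
  by rewrite ler_wpM2l.
have fyp : f (y - p) = f y by rewrite fD fN fp subr0.
have fy0 : f y != 0 by exact/eqP.
have n0 : rnorm (y - p) != 0.
  apply/eqP => /rnorm_eq0 yp; apply: fy.
  by rewrite -fyp yp -(scale0r 0) -(rmorph0 (real_complex R)) fZ mul0r.
exists ((f y / rnorm (y - p) ^+ 2)%:C *: (y - p)) => x.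
(* This combination lies in the kernel of [f], hence is orthogonal to y - p. *)
have := pV (x - (f x / f y)%:C *: (y - p)).
rewrite /= fD fN fZ fyp divfK // subrr.
move=> /(_ erefl); rewrite rdotDr rdotNr !rdotZr rdotxx => /eqP.
rewrite subr_eq0 rdotC => /eqP ->; by field; rewrite n0 fy0.
Qed.

(** As [adjoint] selects by [get], existence is what must be shown. Riesz representation of Re <T x,
    y> gives a real adjoint, and complex linearity of [T] turns its identity into the complex
    one. *)
Lemma adjointP T : bounded_op T -> is_adjoint T (adjoint T).
Proof.
move=> bT; have /bounded_opP[linT [M M0 hM]] := bT.
have ex y : exists z, forall x, rdot (T x) y = rdot x z.
  apply: (@riesz_representation _ (M * rnorm y)) => [x z|r x|x].
  - by rewrite linear_mapD // rdotDl.
  - by rewrite linear_mapZ // rdotZl.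
  - by rewrite mulrAC (le_trans (rdot_CSN _ _)) // ler_wpM2r ?rnorm_ge0.
have [S hS] := choice ex.
apply: getPex; exists S; split.
  apply/bounded_opP; split=> [c x y|].
    apply: rdot_inj => z.
    rewrite rdotDr -!hS rdotDr; congr (_ + _).
    by rewrite !(rdot_conjr c) -hS linear_mapZ.
  exists M => // y.
  have [->|y0] := eqVneq (S y) 0; first by rewrite rnorm0 mulr_ge0 ?rnorm_ge0.
  have n0 : 0 < rnorm (S y).
    by rewrite lt_def rnorm_ge0 andbT; apply: contra_neq y0; exact: rnorm_eq0.
  rewrite -(ler_pM2l n0) -expr2 -rdotxx -hS.
  apply: le_trans (rdot_CS _ _) _.
  by rewrite mulrA (mulrC _ M) ler_wpM2r ?rnorm_ge0.
by move=> x y; rewrite !inner_rdot -linear_mapZ // !hS.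
Qed.

Section PositiveOperators.
Variable A : H -> H.
Hypothesis pA : positive_op A.

Let linA : linear A. Proof. by case: pA => -[]. Qed.

Lemma positive_op_ge0 x : 0 <= rdot (A x) x.
Proof. by case: pA => _ /(_ x); rewrite /rdot; case: inner => a b; rewrite lecE /= => /andP[]. Qed.

(** Over complex scalars a real quadratic form forces symmetry: the imaginary part of <A z, z>
    vanishes, and z = x + i y polarizes this. *)
Lemma positive_op_sym x y : rdot (A x) y = rdot x (A y).
Proof.
have im z : rdot ('i%C *: A z) z = 0.
  case: pA => _ /(_ z); rewrite lecE inner_rdot /= => /andP[/eqP + _].
  by simpc; lra.
have := im (x + 'i%C *: y).
rewrite linear_mapD // linear_mapZ // scalerDr scalerA -expr2 sqr_i scaleN1r.
by rewrite !rdotE !im rdot_ii rdot_ir im (rdotC x); lra.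
Qed.

(** Positivity at M x - A x, combined with <A A x, A x> <= M |A x|^2, leaves M |A x|^2 <= M^2 <A x,
    x>. *)
Lemma positive_op_norm_sq M x : 0 <= M -> (forall x, rnorm (A x) <= M * rnorm x) ->
  rnorm (A x) ^+ 2 <= M * rdot (A x) x.
Proof.
move=> M0 hM.
have [M0'|M0'] := eqVneq M 0.
  have -> : A x = 0.
    by apply: rnorm_eq0; apply/eqP; rewrite eq_le rnorm_ge0 andbT; have := hM x; rewrite M0' mul0r.
  by rewrite rdot0l rnorm0 mulr0 expr0n.
have Mp : 0 < M by rewrite lt_def M0'.
have := positive_op_ge0 (M%:C *: x - A x).
have hAA : rdot (A (A x)) (A x) <= M * rnorm (A x) ^+ 2.
  by rewrite expr2 mulrA (le_trans (rdot_CS _ _)) // ler_wpM2r ?rnorm_ge0.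
rewrite linear_mapB // linear_mapZ // !rdotE (positive_op_sym (A x) x) rdotxx => h.
rewrite -(ler_pM2l Mp); nra.
Qed.

End PositiveOperators.

Lemma positive_opI A : bounded_op A -> (forall x y, rdot (A x) y = rdot x (A y)) ->
  (forall x, 0 <= rdot (A x) x) -> positive_op A.
Proof.
move=> bA sA pA; split=> // x.
have [linA _] := bA.
have h : rdot ('i%C *: A x) x = 0.
  have : rdot ('i%C *: A x) x = rdot ('i%C *: x) (A x).
    by rewrite -linear_mapZ // sA.
  by rewrite [in RHS]rdotC rdot_ir; lra.
by rewrite inner_rdot h rmorph0 mulr0 subr0 ler0c.
Qed.

End Operators.

(** * Square roots of positive operators *)

Section SquareRoot.
Variables (R : realType) (H : hilbertType R) (B : H -> H).
Hypotheses (linB : linear B) (symB : forall x y, rdot (B x) y = rdot x (B y)).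
Hypothesis contrB : forall x, rnorm (B x) <= rnorm x.
Implicit Types (x y z : H) (Y Z : H -> H) (c d r e : R) (m n : nat).

(* [nonneg_poly Y c]: Y = p(B) for a polynomial p with nonnegative coefficients
   and p(1) = c; since B is a contraction, c bounds the norm of Y. *)
Inductive nonneg_poly : (H -> H) -> R -> Prop :=
| nonneg_poly0 : nonneg_poly (fun=> 0) 0
| nonneg_polyX : nonneg_poly B 1
| nonneg_polyD Y Z c d : nonneg_poly Y c -> nonneg_poly Z d ->
    nonneg_poly (fun x => Y x + Z x) (c + d)
| nonneg_polyM Y Z c d : nonneg_poly Y c -> nonneg_poly Z d ->
    nonneg_poly (Y \o Z) (c * d)
| nonneg_polyZ r Y c : 0 <= r -> nonneg_poly Y c ->
    nonneg_poly (fun x => r%:C *: Y x) (r * c).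

Lemma nonneg_poly_linear Y c : nonneg_poly Y c -> linear Y.
Proof.
elim=> {Y c} [a x y|//|Y Z c d _ lY _ lZ a x y|Y Z c d _ lY _ lZ|r Y c _ _ lY a x y].
- by rewrite scaler0 addr0.
- by rewrite lY lZ scalerDr addrACA.
- exact: linear_comp.
- by rewrite lY scalerDr !scalerA mulrC.
Qed.

Lemma nonneg_poly_norm Y c : nonneg_poly Y c ->
  0 <= c /\ forall x, rnorm (Y x) <= c * rnorm x.
Proof.
elim=> {Y c} [||Y Z c d _ [c0 hY] _ [d0 hZ]|Y Z c d _ [c0 hY] _ [d0 hZ]|r Y c r0 _ [c0 hY]].
- by split=> // x; rewrite rnorm0 mul0r.
- by split=> // x; rewrite mul1r.
- split=> [|x]; first exact: addr_ge0.
  by rewrite mulrDl (le_trans (rnormD _ _)) // lerD.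
- split=> [|x]; first exact: mulr_ge0.
  by rewrite (le_trans (hY _)) // -mulrA ler_wpM2l.
- split=> [|x]; first exact: mulr_ge0.
  by rewrite rnormZ ger0_norm // -mulrA ler_wpM2l.
Qed.

Lemma nonneg_poly_comm_with Z Y c : linear Z -> (forall x, Z (B x) = B (Z x)) ->
  nonneg_poly Y c -> forall x, Z (Y x) = Y (Z x).
Proof.
move=> lZ ZB; elim=> {Y c} [x|//|Y Y' c d _ hY _ hY' x|Y Y' c d _ hY _ hY' x|r Y c _ _ hY x].
- by rewrite linear_map0.
- by rewrite linear_mapD // hY hY'.
- by rewrite /= hY hY'.
- by rewrite linear_mapZ // hY.
Qed.

Lemma nonneg_poly_comm Y Z c d : nonneg_poly Y c -> nonneg_poly Z d ->
  forall x, Y (Z x) = Z (Y x).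
Proof.
move=> pY pZ; apply: (nonneg_poly_comm_with (nonneg_poly_linear pY) _ pZ) => x.
by symmetry; apply: (nonneg_poly_comm_with linB _ pY).
Qed.

Lemma nonneg_poly_sym Y c : nonneg_poly Y c -> forall x y, rdot (Y x) y = rdot x (Y y).
Proof.
elim=> {Y c} [x y|//|Y Z c d _ hY _ hZ x y|Y Z c d pY hY pZ hZ x y|r Y c _ _ hY x y].
- by rewrite rdot0l rdotC rdot0l.
- by rewrite rdotDl rdotDr hY hZ.
- by rewrite /= hY hZ (nonneg_poly_comm pY pZ).
- by rewrite rdotZl rdotZr hY.
Qed.

(** The iteration Y := (B + Y^2) / 2 started at 0, which approximates 1 - sqrt (1 - B). *)
Fixpoint sqrt_iter n : H -> H :=
  if n is m.+1 then fun x => (2^-1)%:C *: (B x + sqrt_iter m (sqrt_iter m x)) else fun=> 0.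

(** The value at 1 of the polynomial in [B] that defines [sqrt_iter n]. *)
Fixpoint sqrt_bound n : R :=
  if n is m.+1 then 2^-1 * (1 + sqrt_bound m * sqrt_bound m) else 0.

Lemma sqrt_iterP n : nonneg_poly (sqrt_iter n) (sqrt_bound n).
Proof.
elim: n => [|n IHn]; first exact: nonneg_poly0.
apply: (@nonneg_polyZ 2^-1 (fun x => B x + sqrt_iter n (sqrt_iter n x))) => //.
apply: nonneg_polyD; first exact: nonneg_polyX.
exact: (nonneg_polyM IHn IHn).
Qed.

(** By commutation Y_(n+2) - Y_(n+1) = (Y_(n+1) - Y_n) (Y_(n+1) + Y_n) / 2, so nonnegativity of
    coefficients passes from one increment to the next. *)
Lemma sqrt_iter_stepP n :
  nonneg_poly (fun x => sqrt_iter n.+1 x - sqrt_iter n x) (sqrt_bound n.+1 - sqrt_bound n).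
Proof.
elim: n => [|n IHn].
  have := nonneg_polyZ (r := 2^-1) _ nonneg_polyX.
  rewrite invr_ge0 ler0n => /(_ isT).
  congr nonneg_poly; last by rewrite /=; lra.
  by apply/funext => x /=; rewrite addr0 subr0.
have p1 := sqrt_iterP n.+1; have p0 := sqrt_iterP n.
have h2 : (0 : R) <= 2^-1 by rewrite invr_ge0 ler0n.
have := nonneg_polyZ h2 (nonneg_polyM IHn (nonneg_polyD p1 p0)).
move: p1 p0; set Y1 := sqrt_iter n.+1; set Y0 := sqrt_iter n.
set c1 := sqrt_bound n.+1; set c0 := sqrt_bound n => p1 p0.
congr nonneg_poly; last first.
  have -> : sqrt_bound n.+2 = 2^-1 * (1 + c1 * c1) by [].
  have -> : c1 = 2^-1 * (1 + c0 * c0) by [].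
  ring.
apply/funext => x /=; rewrite -/Y0 -/Y1.
rewrite (linear_mapD (nonneg_poly_linear p0)) (linear_mapD (nonneg_poly_linear p1)).
rewrite -[Y1 (Y0 x)](nonneg_poly_comm p0 p1) -[RHS]scalerBr; congr (_ *: _).
by apply: rdot_inj => z; rewrite !rdotE; ring.
Qed.

Lemma sqrt_bound_le1 n : 0 <= sqrt_bound n <= 1.
Proof. by elim: n => [|n /andP[h0 h1]] /=; [rewrite lexx ler01|apply/andP; split; nra]. Qed.

Lemma sqrt_iterB n m x : (n <= m)%N ->
  rnorm (sqrt_iter m x - sqrt_iter n x) <= (sqrt_bound m - sqrt_bound n) * rnorm x.
Proof.
move=> /subnK <-; elim: (m - n)%N => [|k IHk]; first by rewrite add0n !subrr rnorm0 mul0r.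
rewrite addSn; have [_ /(_ x) h] := nonneg_poly_norm (sqrt_iter_stepP (k + n)).
by have := rnormB_trans (sqrt_iter (k + n) x) (sqrt_iter (k + n).+1 x) (sqrt_iter n x); lra.
Qed.

(** The last equation says (1 - Y)^2 = 1 - B. The iterates converge at the rate [L - sqrt_bound n],
    where [L] is the supremum of the scalar bounds. *)
Lemma contraction_sqrt : exists Y, [/\ linear Y, (forall x, rnorm (Y x) <= rnorm x),
  (forall x y, rdot (Y x) y = rdot x (Y y)) & forall x, Y x + Y x = B x + Y (Y x)].
Proof.
pose D := range sqrt_bound.
have supD : has_sup D.
  split; first by exists (sqrt_bound 0); exists 0%N.
  by exists 1 => _ [n _ <-]; case/andP: (sqrt_bound_le1 n).
pose L := sup D.
have c_le n : sqrt_bound n <= L by apply: ub_le_sup; [case: supD | exists n].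
have L1 : L <= 1.
  by apply: ge_sup; [case: supD | move=> _ [n _ <-]; case/andP: (sqrt_bound_le1 n)].
have small (C e : R) : 0 <= C -> 0 < e -> exists n, (L - sqrt_bound n) * C <= e.
  move=> C0 e0; have e1 : 0 < e / (C + 1) by rewrite divr_gt0 // ltr_wpDl.
  have [_ [n _ <-] hn] := sup_adherent e1 supD.
  exists n; have {}hn : L - sqrt_bound n <= e / (C + 1) by rewrite lerBlDr -lerBlDl ltW.
  have C1 : 0 < C + 1 by rewrite ltr_wpDl.
  apply: le_trans (ler_wpM2r C0 hn) _.
  by rewrite mulrAC ler_pdivrMr // ler_pM2l // lerDl.
have lim0 (C a : R) : 0 <= C -> (forall n, a <= (L - sqrt_bound n) * C) -> a <= 0.
  move=> C0 h; apply: (@ge0_le_eps _ _ 1) => // e e0.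
  by rewrite mul1r; have [n hn] := small C e C0 e0; apply: le_trans (h n) hn.
have lim_eq (C : R) (u v : H) : 0 <= C ->
    (forall n, rnorm (u - v) <= (L - sqrt_bound n) * C) -> u = v.
  move=> C0 /(lim0 _ _ C0) h; apply/eqP; rewrite -subr_eq0; apply/eqP/rnorm_eq0/eqP.
  by rewrite eq_le h rnorm_ge0.
have ex x : exists y, forall n, rnorm (sqrt_iter n x - y) <= (L - sqrt_bound n) * rnorm x.
  pose G e := [set z | exists2 n, z = sqrt_iter n x & (L - sqrt_bound n) * rnorm x <= e].
  have [e e0|e d z w e0 d0 [n -> hn] [m -> hm]|y hy] := @approximation_limit _ _ G.
  - by have [n hn] := small (rnorm x) e (rnorm_ge0 x) e0; exists (sqrt_iter n x), n.
  - have Ln i : 0 <= (L - sqrt_bound i) * rnorm x by rewrite mulr_ge0 ?rnorm_ge0 ?subr_ge0.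
    have := Ln n; have := Ln m.
    have [nm|/ltnW mn] := leqP n m.
      by have := sqrt_iterB x nm; rewrite rnormBC; lra.
    by have := sqrt_iterB x mn; lra.
  exists y => n; apply/ler_addgt0Pr => e e0; apply: hy.
    by rewrite ltr_wpDl // mulr_ge0 ?rnorm_ge0 ?subr_ge0.
  by exists n => //; rewrite lerDl ltW.
have [Y hY] := choice ex.
have lY n := nonneg_poly_linear (sqrt_iterP n).
have nY n := proj2 (nonneg_poly_norm (sqrt_iterP n)).
have sY n := nonneg_poly_sym (sqrt_iterP n).
have normY x : rnorm (Y x) <= rnorm x.
  (* At index 0 the iterate and its bound are 0, so the rate is L <= 1. *)
  have := hY x 0%N; rewrite /= sub0r rnormN subr0 => /le_trans; apply.
  by rewrite ler_piMl ?rnorm_ge0.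
exists Y; split=> // [a x y|x y|x].
- pose C := rnorm (a *: x + y) + rnorm (a *: x) + rnorm y.
  apply: (lim_eq C) => [|n]; first by rewrite !addr_ge0 ?rnorm_ge0.
  have h1 := hY (a *: x + y) n; have h2 := hY x n; have h3 := hY y n.
  have {}h2 : rnorm (a *: sqrt_iter n x - a *: Y x) <= (L - sqrt_bound n) * rnorm (a *: x).
    rewrite -scalerBr !rnormZc mulrCA ler_wpM2l //.
    by have := normr_ge0 a; rewrite lecE => /andP[].
  have h := rnormB_trans (sqrt_iter n (a *: x + y)) (Y (a *: x + y)) (a *: Y x + Y y).
  rewrite /C -addrA mulrDr; apply: (le_trans h); apply: lerD; first by rewrite rnormBC.
  rewrite lY opprD addrACA mulrDr.
  by apply: le_trans (rnormD _ _) _; apply: lerD.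
- apply/eqP; rewrite -subr_eq0 -normr_eq0 eq_le normr_ge0 andbT.
  have C0 : 0 <= 2 * rnorm x * rnorm y by rewrite !mulr_ge0 ?rnorm_ge0.
  apply: (lim0 _ _ C0) => n.
  have -> : rdot (Y x) y - rdot x (Y y) =
      rdot x (sqrt_iter n y - Y y) - rdot (sqrt_iter n x - Y x) y.
    by rewrite !rdotE sY; ring.
  have h1 := hY x n; have h2 := hY y n.
  have := rdot_CSN x (sqrt_iter n y - Y y); have := rdot_CSN (sqrt_iter n x - Y x) y.
  have := ler_normB (rdot x (sqrt_iter n y - Y y)) (rdot (sqrt_iter n x - Y x) y).
  have := ler_wpM2r (rnorm_ge0 y) h1; have := ler_wpM2l (rnorm_ge0 x) h2.
  nra.
(* The residual splits into three errors, with weights 1, 1 and 2, each at most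
   [(L - sqrt_bound n) * rnorm x]. *)
- apply: (lim_eq (4 * rnorm x)) => [|n]; first by rewrite mulr_ge0 ?rnorm_ge0.
  have h0 := hY x n.+1; have h1 := hY x n; have h2 := hY (Y x) n.
  have h3 := nY n (sqrt_iter n x - Y x).
  have h4 := normY x; have /andP[c0 c1] := sqrt_bound_le1 n.
  have hc : sqrt_bound n <= sqrt_bound n.+1 by rewrite /=; nra.
  have hL := c_le n.
  have -> : Y x + Y x - (B x + Y (Y x)) =
    (sqrt_iter n (sqrt_iter n x - Y x) + (sqrt_iter n (Y x) - Y (Y x)))
      - (2:R)%:C *: (sqrt_iter n.+1 x - Y x).
    by rewrite /= (linear_mapB (lY n)); apply: rdot_inj => z; rewrite !rdotE; field.
  apply: le_trans (rnormD _ _) _; rewrite rnormN rnormZ normr_nat.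
  have := rnormD (sqrt_iter n (sqrt_iter n x - Y x)) (sqrt_iter n (Y x) - Y (Y x)).
  have hx := rnorm_ge0 x.
  have g1 : sqrt_bound n * rnorm (sqrt_iter n x - Y x) <= (L - sqrt_bound n) * rnorm x.
    by apply: le_trans h1; rewrite ler_piMl ?rnorm_ge0.
  have g2 : rnorm (sqrt_iter n (Y x) - Y (Y x)) <= (L - sqrt_bound n) * rnorm x.
    by apply: (le_trans h2); rewrite ler_wpM2l ?subr_ge0.
  have g3 : rnorm (sqrt_iter n.+1 x - Y x) <= (L - sqrt_bound n) * rnorm x.
    by apply: (le_trans h0); rewrite ler_wpM2r // lerB.
  move: h3 g1 g2 g3; rewrite -[sqrt_iter n.+1 x]/(sqrt_iter n.+1 x); lra.
Qed.

End SquareRoot.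

(** Rescaling reduces to a contraction: B = 1 - A / K with K = M + 1 > 0, and S = sqrt K (1 - Y),
    where (1 - Y)^2 = 1 - B = A / K. *)
Lemma sqrt_opP (R : realType) (H : hilbertType R) (A : H -> H) :
  positive_op A -> is_sqrt_op A (sqrt_op A).
Proof.
move=> pA; apply: getPex.
have [bA _] := pA; have /bounded_opP[linA [M M0 hM]] := bA.
pose K := M + 1; have K0 : 0 < K by rewrite ltr_wpDl.
pose B x := x - (K^-1)%:C *: A x.
have bB : bounded_op B.
  have -> : B = fun x => x + (- K^-1)%:C *: A x.
    by apply/funext => x; rewrite rmorphN scaleNr.
  apply: bounded_opD; last exact: bounded_opZ.
  by apply/bounded_opP; split=> //; exists 1 => // x; rewrite mul1r.
have symB x y : rdot (B x) y = rdot x (B y).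
  by rewrite !rdotE positive_op_sym.
have contrB x : rnorm (B x) <= rnorm x.
  rewrite -ler_sqr ?nnegrE ?rnorm_ge0 // rnormB_sq rnormZ rdotZr exprMn.
  (* With this bound |x|^2 - 2 <A x, x> / K + |A x|^2 / K^2 is at most |x|^2 - <A x, x> / K. *)
  have h : rnorm (A x) ^+ 2 <= K * rdot (A x) x.
    apply: positive_op_norm_sq => // [|y]; first exact: ltW.
    by apply: le_trans (hM y) _; rewrite ler_wpM2r ?rnorm_ge0 // lerDl.
  rewrite real_normK ?num_real // (rdotC x).
  have := positive_op_ge0 pA x; have Ki : 0 < K^-1 by rewrite invr_gt0.
  have := ler_wpM2l (ltW (exprn_gt0 2 Ki)) h.
  rewrite expr2 (mulrA _ K) mulfVK ?gt_eqF //; nra.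
have [Y [linY contrY symY fixY]] := contraction_sqrt (proj1 bB) symB contrB.
pose s := Num.sqrt K; have s0 : 0 <= s by exact: sqrtr_ge0.
pose S x := s%:C *: (x - Y x).
have bS : bounded_op S.
  apply/bounded_opP; split=> [c x y|].
    by rewrite /S linY opprD addrACA -scalerBr scalerDr !scalerA mulrC.
  exists (s * 2) => [|x]; first exact: mulr_ge0.
  rewrite rnormZ ger0_norm // -mulrA ler_wpM2l //.
  by apply: le_trans (rnormD _ _) _; rewrite rnormN; have := contrY x; lra.
exists S; split.
  apply: positive_opI => // [x y|x]; first by rewrite !rdotE symY.
  rewrite rdotZl mulr_ge0 // rdotDl rdotNl rdotxx subr_ge0.
  by apply: le_trans (rdot_CS _ _) _; rewrite expr2 ler_wpM2r ?rnorm_ge0.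
apply/funext => x; rewrite /= /S (linear_mapZ linY) (linear_mapB linY) -scalerBr scalerA.
rewrite -rmorphM /= -expr2 sqr_sqrtr ?ltW //.
have -> : x - Y x - (Y x - Y (Y x)) = (K^-1)%:C *: A x.
  apply: rdot_inj => z; have := congr1 (rdot z) (fixY x).
  by rewrite /B !rdotE; lra.
by rewrite scalerA -rmorphM /= divff ?gt_eqF // scale1r.
Qed.

(** * Modulus and polar decomposition *)

Section PolarDecomposition.
Variables (R : realType) (H : hilbertType R).
Implicit Types (x y z u : H) (e : R) (T S U A : H -> H).

Lemma adherent_orthogonal (V : set H) u :
  adherent V u -> (forall v, V v -> rdot u v = 0) -> u = 0.
Proof.
move=> aV ou; apply/rnorm_eq0/eqP; rewrite -sqrf_eq0 eq_le sqr_ge0 andbT.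
apply: (@ge0_le_eps _ _ (rnorm u)) => [|e e0]; first exact: rnorm_ge0.
have [v Vv vu] := aV e e0.
rewrite -rdotxx -[X in rdot _ X](subrK v) rdotDr (ou _ Vv) addr0.
by apply: le_trans (rdot_CS _ _) _; rewrite rnormBC ler_wpM2l ?rnorm_ge0.
Qed.

Lemma adherent_orthogonal_pair (V : set H) u z :
  adherent V u -> (forall v, V v -> rdot z v = 0) -> rdot z u = 0.
Proof.
move=> aV oz; apply/normr0_eq0/eqP; rewrite eq_le normr_ge0 andbT.
apply: (@ge0_le_eps _ _ (rnorm z)) => [|e e0]; first exact: rnorm_ge0.
have [v Vv vu] := aV e e0.
rewrite -[X in rdot _ X](subrK v) rdotDr (oz _ Vv) addr0.
by apply: le_trans (rdot_CSN _ _) _; rewrite rnormBC ler_wpM2l ?rnorm_ge0.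
Qed.

Lemma range_subspace A : linear A -> real_subspace (range A).
Proof.
move=> lA; split; first by exists 0 => //; rewrite linear_map0.
- by move=> _ _ [x _ <-] [y _ <-]; exists (x + y) => //; rewrite linear_mapD.
- by move=> r _ [x _ <-]; exists (r%:C *: x) => //; rewrite linear_mapZ.
Qed.

Lemma adherentD (V : set H) x y : real_subspace V ->
  adherent V x -> adherent V y -> adherent V (x + y).
Proof.
move=> [_ VD _] ax ay e e0; have e2 : 0 < e / 2 by rewrite divr_gt0.
have [v Vv hv] := ax _ e2; have [w Vw hw] := ay _ e2.
exists (v + w); first exact: VD.
by rewrite opprD addrACA; have := rnormD (v - x) (w - y); lra.
Qed.

Lemma adherent_rangeZ A (c : R[i]) x : linear A ->
  adherent (range A) x -> adherent (range A) (c *: x).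
Proof.
move=> lA ax e e0; have c0 : 0 <= complex.Re `|c|.
  by have := normr_ge0 c; rewrite lecE => /andP[].
have c1 : 0 < complex.Re `|c| + 1 by rewrite ltr_wpDl.
have [_ [v _ <-] hv] := ax _ (divr_gt0 e0 c1).
exists (A (c *: v)); first by exists (c *: v).
rewrite linear_mapZ // -scalerBr rnormZc.
apply: le_trans (ler_wpM2l c0 hv) _.
by rewrite mulrA ler_pdivrMr // mulrC ler_pM2l // lerDl.
Qed.

Lemma symmetric_kernel A x : (forall x y, rdot (A x) y = rdot x (A y)) ->
  (forall y, rdot x (A y) = 0) -> A x = 0.
Proof. by move=> sA h; apply: rdot_eq0 => y; rewrite rdotC sA h. Qed.

(** The map A x -> T x is isometric, so it sends approximations of [y] to Cauchy approximations; [l]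
    is the value at [y] of its continuous extension. *)
Lemma isometric_extension A T y : linear A -> linear T ->
  (forall x, rnorm (A x) = rnorm (T x)) -> adherent (range A) y ->
  exists2 l, adherent (range T) l & forall x, rnorm (T x - l) <= rnorm (A x - y).
Proof.
move=> lA lT AT ay.
pose G e := [set z | exists2 x, rnorm (A x - y) <= e & z = T x].
have [e e0|e d z w _ _ [x hx ->] [x' hx' ->]|l hl] := @approximation_limit _ _ G.
- by have [_ [x _ <-] hx] := ay e e0; exists (T x), x.
- rewrite -linear_mapB // -AT linear_mapB //.
  by have := rnormB_trans y (A x) (A x'); rewrite (rnormBC y); lra.
exists l => [e e0|x].
  have [_ [x _ <-] hx] := ay e e0; exists (T x); first by exists x.
  by apply: hl e0 _; exists x.
apply/ler_addgt0Pr => e e0; apply: hl; first by rewrite ltr_wpDl ?rnorm_ge0.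
by exists x => //; rewrite lerDl ltW.
Qed.

Lemma adjoint_rdot T x y : bounded_op T -> rdot (T x) y = rdot x (adjoint T y).
Proof. by move=> /adjointP[_ h]; rewrite /rdot h. Qed.

Lemma abs_opP T : bounded_op T ->
  positive_op (abs_op T) /\ forall x y, rdot (abs_op T x) (abs_op T y) = rdot (T x) (T y).
Proof.
move=> bT; have [bTa _] := adjointP bT.
have [|pA AA] := @sqrt_opP _ _ (adjoint T \o T).
  apply: positive_opI => [|x y|x]; first exact: bounded_op_comp.
  - by rewrite /= -adjoint_rdot // rdotC -adjoint_rdot // rdotC.
  - by rewrite /= rdotC -adjoint_rdot // rdotxx sqr_ge0.
split=> // x y.
rewrite rdotC positive_op_sym // -[abs_op T (abs_op T x)]/((abs_op T \o abs_op T) x) AA.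
by rewrite /= -adjoint_rdot // rdotC.
Qed.

Lemma rnorm_abs_op T x : bounded_op T -> rnorm (abs_op T x) = rnorm (T x).
Proof.
move=> bT; have [_ /(_ x x)] := abs_opP bT; rewrite !rdotxx => /eqP.
by rewrite eqrXn2 ?rnorm_ge0 // => /eqP.
Qed.

(** [U y] is the unique vector in the closure of the range of [T] with <U y, T x> = <y, A x> for all
    [x]. It is found by projecting [y] on the closure of the range of [A] and applying the extended
    isometry; uniqueness yields linearity and U A = T. *)
Lemma polar_partP T : bounded_op T -> is_polar_part T (polar_part T).
Proof.
move=> bT; apply: getPex; have [lT _] := bT.
have [pA AT] := abs_opP bT; have nA x := rnorm_abs_op x bT.
set A := abs_op T in pA AT nA *.
have lA : linear A by case: pA => -[].
have sA := positive_op_sym pA.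
have ex y : exists u, adherent (range T) u /\ forall x, rdot u (T x) = rdot y (A x).
  have [p ap op] := orthogonal_projection y (range_subspace lA).
  have [u au hu] := isometric_extension lA lT nA ap.
  exists u; split=> // x; rewrite -[y in RHS](subrK p) rdotDl op ?add0r; last by exists x.
  apply/eqP; rewrite -subr_eq0 -normr_eq0 eq_le normr_ge0 andbT.
  apply: (@ge0_le_eps _ _ (2 * rnorm (T x))) => [|e e0]; first by rewrite mulr_ge0 ?rnorm_ge0.
  have [_ [v _ <-] hv] := ap e e0; have hu' := le_trans (hu v) hv.
  have -> : rdot u (T x) - rdot p (A x) = rdot (A v - p) (A x) - rdot (T v - u) (T x).
    by rewrite !rdotE AT; ring.
  have := rdot_CSN (A v - p) (A x); have := rdot_CSN (T v - u) (T x); rewrite nA.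
  have := ler_normB (rdot (A v - p) (A x)) (rdot (T v - u) (T x)).
  have := ler_wpM2r (rnorm_ge0 (T x)) hv; have := ler_wpM2r (rnorm_ge0 (T x)) hu'.
  lra.
have [U hU] := choice ex.
have aU y : adherent (range T) (U y) by case: (hU y).
have dU y x : rdot (U y) (T x) = rdot y (A x) by case: (hU y).
have uniq u y : adherent (range T) u -> (forall x, rdot u (T x) = rdot y (A x)) -> U y = u.
  move=> au du; apply/eqP; rewrite -subr_eq0; apply/eqP.
  apply: (@adherent_orthogonal (range T)) => [|_ [x _ <-]].
    apply: adherentD => //; first exact: range_subspace.
    by rewrite -scaleN1r; apply: adherent_rangeZ.
  by rewrite rdotDl rdotNl dU du subrr.
have lU : linear U.
  move=> c y z; apply: uniq => [|x].
    by apply: adherentD; [exact: range_subspace | exact: adherent_rangeZ |].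
  by rewrite !rdotDl !rdot_conj -(linear_mapZ lT) -(linear_mapZ lA) !dU.
have UA x : U (A x) = T x.
  by apply: uniq => // e e0; exists (T x); [exists x | rewrite subrr rnorm0 ltW].
have nU y : rnorm (U y) <= rnorm y.
  have [->|n0] := eqVneq (rnorm (U y)) 0; first exact: rnorm_ge0.
  have {}n0 : 0 < rnorm (U y) by rewrite lt_def n0 rnorm_ge0.
  rewrite -(ler_pM2l n0) -subr_le0 -expr2 -rdotxx.
  (* For T x within [e] of U y, |U y|^2 = <U y, U y - T x> + <y, A x> <= |U y| e + |y| (|U y| +
     e). *)
  apply: (@ge0_le_eps _ _ (rnorm y + rnorm (U y))) => [|e e0]; first by rewrite addr_ge0 ?rnorm_ge0.
  have [_ [x _ <-] hx] := aU y e e0.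
  rewrite -[X in rdot _ X](subrK (T x)) rdotDr dU.
  have := rdot_CS (U y) (U y - T x); rewrite rnormBC.
  have := rdot_CS y (A x); rewrite nA.
  have : rnorm (T x) <= rnorm (U y) + e.
    by have := rnormB_trans (U y) (T x) 0; rewrite !subr0; lra.
  have := rnorm_ge0 y; nra.
exists U; split; last by apply/funext => x /=; rewrite UA.
- split=> [|y oy].
    by apply/bounded_opP; split=> //; exists 1 => // x; rewrite mul1r.
  (* [U] kills y - p, so a [y] orthogonal to the kernel equals [p]; on the closure of the range of
     [A] norms are kept, as |U A x| = |A x|. *)
  have [p ap op] := orthogonal_projection y (range_subspace lA).
  have kyp : U (y - p) = 0.
    apply: (@adherent_orthogonal (range T)) => // _ [x _ <-]; by rewrite dU op.
  have yp : y = p.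
    apply/eqP; rewrite -subr_eq0; apply/eqP/rnorm_eq0/eqP; rewrite -sqrf_eq0 -rdotxx.
    rewrite rdotDr rdotNr (adherent_orthogonal_pair ap op) subr0 rdotC.
    by rewrite /rdot (oy _ kyp).
  rewrite !rnormE; congr (_%:C); apply/eqP; rewrite eq_le nU /= -subr_le0.
  apply: (@ge0_le_eps _ _ 2) => // e e0.
  move: ap; rewrite -yp => /(_ e e0)[_ [x _ <-] hx].
  have := nU (A x - y); rewrite (linear_mapB lU) UA => h.
  have := rnormB_trans (A x) y 0; have := rnormB_trans (U y) (T x) 0.
  by rewrite !subr0 nA (rnormBC y); lra.
- apply/seteqP; split=> y /= h.
    apply: rnorm_eq0; rewrite -nA (symmetric_kernel sA) ?rnorm0 // => x.
    by rewrite -dU h rdot0l.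
  apply: (@adherent_orthogonal (range T)) => // _ [x _ <-].
  by rewrite dU -sA (rnorm_eq0 (x := A y)) ?rdot0l // nA h rnorm0.
Qed.

End PolarDecomposition.

(** * Uniform boundedness principle *)

Section UniformBoundedness.
Variables (R : realType) (H : hilbertType R).

Lemma succ_mul_expr3V_le1 (n : nat) : (n.+1%:R : R) * 3 ^- n <= 1.
Proof.
elim: n => [|n IHn]; first by rewrite expr0 invr1 mulr1.
have h : 0 < 3 ^- n :> R by rewrite invr_gt0 exprn_gt0.
rewrite exprS invfM -natr1; have := ler0n R n; move: IHn; rewrite -natr1; nra.
Qed.

(* Gliding hump: x_(n+1) = x_n +- 3^-n y_n / |y_n| makes |<x_(n+1), y_n>| at least
   3^-n |y_n|, and the later steps change this by at most half of it. *)
Lemma pointwise_bounded_set (V : set H) :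
  (forall x, exists M, forall y, V y -> `|rdot x y| <= M) ->
  exists M, forall y, V y -> rnorm y <= M.
Proof.
move=> pb; apply: contrapT => /forallNP nb.
(* The threshold makes 3^-n |y_n| exceed 2 n, so half of the hump still exceeds n. *)
have big (n : nat) : exists y, V y /\ 2 * n%:R * 3 ^+ n < rnorm y.
  have /existsNP[y /not_implyP[Vy /negP]] := nb (2 * n%:R * 3 ^+ n).
  by rewrite -ltNge; exists y.
have [y /all_and2[Vy hy]] := choice big.
have e3 (n : nat) : 0 < 3 ^- n :> R by rewrite invr_gt0 exprn_gt0.
have y0 n : 0 < rnorm (y n).
  by apply: le_lt_trans (hy n); rewrite !mulr_ge0 ?exprn_ge0.
(* The sign is that of <x, y_n>, so the two contributions to <x + step, y_n> add up in absolute
   value. *)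
pose step n x : H :=
  ((if 0 <= rdot x (y n) then 1 else -1) * (3 ^- n / rnorm (y n)))%:C *: y n.
pose fix u n : H := if n is m.+1 then u m + step m (u m) else 0.
have stepN n x : rnorm (step n x) = 3 ^- n.
  rewrite rnormZ normrM normrM (ger0_norm (ltW (e3 n))) normfV (ger0_norm (ltW (y0 n))).
  by case: ifP => _; rewrite ?normrN normr1 mul1r divfK // gt_eqF.
have hump n : 3 ^- n * rnorm (y n) <= `|rdot (u n.+1) (y n)|.
  rewrite /= rdotDl rdotZl rdotxx.
  have E : 3 ^- n / rnorm (y n) * rnorm (y n) ^+ 2 = 3 ^- n * rnorm (y n).
    by rewrite expr2 mulrA divfK // gt_eqF.
  rewrite -mulrA E; have := mulr_gt0 (e3 n) (y0 n).
  by case: ifPn; rewrite ?mul1r ?mulN1r -?ltNge => h h';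
    [apply: le_trans (ler_norm _) | rewrite -normrN; apply: le_trans (ler_norm _)]; lra.
have cauchy_u n m : (n <= m)%N -> rnorm (u m - u n) <= 3 / 2 * (3 ^- n - 3 ^- m).
  move=> /subnK <-; elim: (m - n)%N => [|k IHk]; first by rewrite add0n !subrr rnorm0 mulr0.
  have hs : rnorm (u (k + n).+1 - u (k + n)%N) = 3 ^- (k + n).
    by rewrite /= addrAC subrr add0r stepN.
  rewrite addSn; have := rnormB_trans (u (k + n)%N) (u (k + n).+1) (u n).
  rewrite hs exprS invfM; move: IHk; lra.
pose G (e : R) := [set z | exists2 n, z = u n & 3 / 2 * 3 ^- n <= e].
have small (e : R) : 0 < e -> exists n, 3 / 2 * 3 ^- n <= e.
  move=> e0; have e1 : 0 < e / (3 / 2) by rewrite !divr_gt0.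
  have [n /(_ n (leqnn n)) hn] := inv_succ_le e1.
  exists n; have n1 : 0 < n.+1%:R :> R by rewrite ltr0n.
  have h : 3 ^- n <= n.+1%:R^-1 :> R.
    by rewrite -(ler_pM2l n1) divff ?gt_eqF // succ_mul_expr3V_le1.
  by have := le_trans h hn; rewrite ler_pdivlMr // mulrC.
have [e e0|e d z w e0 d0 [n -> hn] [m -> hm]|l hl] := @approximation_limit _ _ G.
- by have [n hn] := small e e0; exists (u n), n.
- have := e3 n; have := e3 m; have [nm|/ltnW mn] := leqP n m.
    by have := cauchy_u _ _ nm; rewrite rnormBC; lra.
  by have := cauchy_u _ _ mn; lra.
have hul n : rnorm (u n - l) <= 3 / 2 * 3 ^- n.
  by apply: hl; [rewrite mulr_gt0 // | exists n].
have [M hM] := pb l.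
(* An index n > |M| contradicts |<l, y_n>| <= M, since the left side exceeds n. *)
have /andP[_] := truncn_itv (normr_ge0 M); set n := (Num.truncn _).+1 => Mn.
have h1 := hM _ (Vy n).
have h2 := hump n; have h3 := hul n.+1.
have h4 := rdot_CSN (u n.+1 - l) (y n).
have h5 := ler_normD (rdot (u n.+1 - l) (y n)) (rdot l (y n)).
rewrite -rdotDl subrK in h5.
have h6 : rnorm (u n.+1 - l) * rnorm (y n) <= 2^-1 * (3 ^- n * rnorm (y n)).
  rewrite mulrA ler_wpM2r ?rnorm_ge0 //; move: h3; rewrite exprS invfM; lra.
have h7 : 2 * n%:R < 3 ^- n * rnorm (y n).
  by rewrite [ltRHS]mulrC ltr_pdivlMr ?exprn_gt0.
by have := ler_norm M; lra.
Qed.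

End UniformBoundedness.

(** * Lower bounds, surjectivity and invertibility *)

Section Invertibility.
Variables (R : realType) (H : hilbertType R).
Implicit Types (x y z : H) (T S U A : H -> H) (c k : R).

Definition bounded_below T := exists2 c, 0 < c & forall x, c * rnorm x <= rnorm (T x).

Lemma bounded_below_inj T x : bounded_below T -> T x = 0 -> x = 0.
Proof.
move=> [c c0 hT] Tx; apply/rnorm_eq0/eqP; rewrite eq_le rnorm_ge0 andbT.
by have := hT x; rewrite Tx rnorm0 pmulr_rle0.
Qed.

Lemma invertible_opP T : bounded_op T ->
  invertible_op T <-> bounded_below T /\ forall y, exists x, T x = y.
Proof.
move=> bT; have [lT _] := bT; split.
  move=> [S [/bounded_opP[lS [M M0 hM]] ST TS]].
  split=> [|y]; last by exists (S y); rewrite -[RHS]/(id y) -TS.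
  have M1 : 0 < M + 1 by rewrite ltr_wpDl.
  exists (M + 1)^-1; first by rewrite invr_gt0.
  move=> x; rewrite mulrC ler_pdivrMr //.
  have -> : rnorm x = rnorm (S (T x)) by rewrite -[S (T x)]/((S \o T) x) ST.
  by apply: le_trans (hM _) _; rewrite mulrC ler_wpM2l ?rnorm_ge0 // lerDl.
move=> [below surj]; have [S hS] := choice surj.
have inj x y : T x = T y -> x = y.
  move=> h; apply/eqP; rewrite -subr_eq0; apply/eqP/(bounded_below_inj below).
  by rewrite linear_mapB // h subrr.
exists S; split; last by apply/funext => x /=; rewrite hS.
- apply/bounded_opP; split=> [a x y|]; first by apply: inj; rewrite lT !hS.
  have [c c0 hc] := below; exists c^-1; first by rewrite invr_ge0 ltW.
  by move=> x; rewrite mulrC ler_pdivlMr // mulrC -{2}(hS x).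
- by apply/funext => x /=; apply: inj; rewrite hS.
Qed.

(** Every [y] is adherent to the range, and the lower bound makes approximate preimages of [y]
    Cauchy; their limit is a preimage by continuity. *)
Lemma dense_range_surjective T : bounded_op T -> bounded_below T ->
  (forall y, (forall x, rdot (T x) y = 0) -> y = 0) -> forall y, exists x, T x = y.
Proof.
move=> /bounded_opP[lT [M M0 hM]] [c c0 hc] dense y.
have [p ap op] := orthogonal_projection y (range_subspace lT).
have {op} yp : y = p.
  apply/eqP; rewrite -subr_eq0; apply/eqP/dense => x.
  by rewrite rdotC op //; exists x.
rewrite -{}yp in ap.
pose G e := [set z | rnorm (T z - y) <= c * e].
have [e e0|e d z w e0 d0 hz hw|l hl] := @approximation_limit _ _ G.
- by have [_ [x _ <-] hx] := ap _ (mulr_gt0 c0 e0); exists x.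
- rewrite -(ler_pM2l c0) (le_trans (hc _)) // linear_mapB //.
  have := rnormB_trans y (T z) (T w); rewrite (rnormBC y); move: hz hw; rewrite /G /=; lra.
exists l; apply/eqP; rewrite -subr_eq0; apply/eqP/rnorm_eq0/eqP.
rewrite eq_le rnorm_ge0 andbT; apply: (@ge0_le_eps _ _ (M + c)).
  by rewrite addr_ge0 // ltW.
move=> e e0; have [_ [x _ <-] hx] := ap _ (mulr_gt0 c0 e0).
have h := hM (x - l); rewrite linear_mapB // in h.
have := rnormB_trans (T x) (T l) y; rewrite (rnormBC (T l) (T x)).
by have := ler_wpM2l M0 (hl e x e0 hx); lra.
Qed.

(** For a symmetric operator the complement of the range is the kernel, which the lower bound makes
    zero. *)
Lemma symmetric_surjective A : bounded_op A -> (forall x y, rdot (A x) y = rdot x (A y)) ->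
  bounded_below A -> forall y, exists x, A x = y.
Proof.
move=> bA sA below; apply: dense_range_surjective => // y oy.
apply: (bounded_below_inj below); apply: (symmetric_kernel sA) => x.
by rewrite rdotC oy.
Qed.

(* Hellinger-Toeplitz for the inverse of A. *)
Lemma symmetric_surjective_below A : linear A -> (forall x y, rdot (A x) y = rdot x (A y)) ->
  (forall y, exists x, A x = y) -> bounded_below A.
Proof.
move=> lA sA surj.
have inj x : A x = 0 -> x = 0.
  move=> Ax; apply: rdot_eq0 => y; have [z <-] := surj y.
  by rewrite sA Ax rdotC rdot0l.
(* Pointwise bounded: with w = A z, <w, y> = <z, A y> is at most |z| in absolute value. *)
have [|M hM] := @pointwise_bounded_set R H [set y | rnorm (A y) <= 1].
  move=> w; have [z <-] := surj w; exists (rnorm z) => y /= hy.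
  by rewrite sA (le_trans (rdot_CSN _ _)) // ler_piMr ?rnorm_ge0.
have M0 : 0 <= M.
  by have := hM 0; rewrite /= linear_map0 // rnorm0 => /(_ ler01).
have M1 : 0 < M + 1 by rewrite ltr_wpDl.
exists (M + 1)^-1 => [|x]; first by rewrite invr_gt0.
rewrite mulrC ler_pdivrMr //.
have [Ax|nAx] := eqVneq (A x) 0; first by rewrite (inj x Ax) linear_map0 // rnorm0 mul0r.
have n0 : 0 < rnorm (A x).
  by rewrite lt_def rnorm_ge0 andbT; apply: contra_neq nAx; exact: rnorm_eq0.
have := hM ((rnorm (A x))^-1%:C *: x).
rewrite /= linear_mapZ // !rnormZ ger0_norm ?invr_ge0 ?rnorm_ge0 // mulVf ?gt_eqF //.
move=> /(_ (lexx _)); rewrite mulrC ler_pdivrMr // => h.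
by rewrite mulrC; apply: (le_trans h); rewrite ler_wpM2r ?rnorm_ge0 // lerDl.
Qed.

(* With X = a U S + b S U, the operator P below is a X S + b S X, and since U is
   isometric, Re <P x, U x> = |X x|^2, while Re <X x, U x> >= a <S x, x>. *)
Lemma power_mean_coercive S U (a b : R) : 0 < a -> 0 < b ->
  positive_op S -> bounded_below S -> linear U -> (forall x, rnorm (U x) = rnorm x) ->
  exists2 k, 0 < k & forall x, k * rnorm x ^+ 2 <=
    rdot ((a ^+ 2)%:C *: U (S (S x)) + (b ^+ 2)%:C *: S (S (U x))
          + (2 * b * a)%:C *: S (U (S x))) (U x).
Proof.
move=> a0 b0 pS [c c0 hc] lU nU.
have [bS _] := pS; have /bounded_opP[lS [M M0 hM]] := bS.
have sS := positive_op_sym pS.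
have dU x y : rdot (U x) (U y) = rdot x y.
  have := nU (x - y); rewrite (linear_mapB lU) => /(congr1 (fun t => t ^+ 2)).
  by rewrite !rnormB_sq !nU; lra.
have M1 : 0 < M + 1 by rewrite ltr_wpDl.
(* Chain: c^2 |x|^2 <= |S x|^2 <= (M + 1) <S x, x>. *)
have Sge x : c ^+ 2 / (M + 1) * rnorm x ^+ 2 <= rdot (S x) x.
  rewrite mulrAC ler_pdivrMr // -exprMn [leRHS]mulrC.
  apply: le_trans (_ : rnorm (S x) ^+ 2 <= _).
    by rewrite ler_sqr ?nnegrE ?mulr_ge0 ?rnorm_ge0 ?(ltW c0) ?hc.
  apply: positive_op_norm_sq => // [|y]; first exact: ltW.
  by apply: le_trans (hM y) _; rewrite ler_wpM2r ?rnorm_ge0 // lerDl.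
have d0 : 0 < a * (c ^+ 2 / (M + 1)) by rewrite mulr_gt0 // divr_gt0 // exprn_gt0.
exists ((a * (c ^+ 2 / (M + 1))) ^+ 2) => [|x]; first exact: exprn_gt0.
pose X := a%:C *: U (S x) + b%:C *: S (U x).
have -> : rdot ((a ^+ 2)%:C *: U (S (S x)) + (b ^+ 2)%:C *: S (S (U x))
          + (2 * b * a)%:C *: S (U (S x))) (U x) = rnorm X ^+ 2.
  rewrite -rdotxx /X !rdotE !dU !sS (rdotC (U x) (S (U (S x)))) sS; ring.
(* In <X, U x> = a <S x, x> + b <S U x, U x> the last term is nonnegative. *)
have hX : a * (c ^+ 2 / (M + 1)) * rnorm x ^+ 2 <= rnorm X * rnorm x.
  rewrite -{2}(nU x); apply: le_trans (rdot_CS _ _).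
  rewrite /X !rdotE dU -mulrA; have := ler_wpM2l (ltW a0) (Sge x).
  have := mulr_ge0 (ltW b0) (positive_op_ge0 pS (U x)); lra.
have [->|x0] := eqVneq x 0; first by rewrite rnorm0 expr0n mulr0 sqr_ge0.
have n0 : 0 < rnorm x.
  by rewrite lt_def rnorm_ge0 andbT; apply: contra_neq x0; exact: rnorm_eq0.
rewrite -exprMn ler_sqr ?nnegrE ?rnorm_ge0 ?(mulr_ge0 (ltW d0) (ltW n0)) //.
by rewrite -(ler_pM2r n0) -mulrA -expr2.
Qed.

(** * The power mean transform of a bounded operator *)

Section PowerMean.
Variables (lambda : R) (T : H -> H).
Hypotheses (hlambda : 0 < lambda < 1) (bT : bounded_op T).
Let A := abs_op T.
Let S := sqrt_op A.
Let U := polar_part T.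
Let P := power_mean lambda T.

Let lT : linear T. Proof. by case: bT. Qed.

Let pA : positive_op A. Proof. by case: (abs_opP bT). Qed.

Let lA : linear A. Proof. by case: pA => -[]. Qed.

Let nA x : rnorm (A x) = rnorm (T x). Proof. exact: rnorm_abs_op. Qed.

Let pS : positive_op S. Proof. by case: (sqrt_opP pA). Qed.

Let SS x : S (S x) = A x.
Proof. by have [_ <-] := sqrt_opP pA. Qed.

Let bU : bounded_op U. Proof. by case: (polar_partP bT) => -[]. Qed.

Let UA x : U (A x) = T x.
Proof. by have [_ _ /(congr1 (@^~ x))/esym] := polar_partP bT. Qed.

Let bP : bounded_op P.
Proof.
have [bA _] := pA; have [bS _] := pS.
apply: bounded_opD; first apply: bounded_opD; apply: bounded_opZ => //.
- exact: bounded_op_comp.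
- by apply: bounded_op_comp => //; exact: bounded_op_comp.
Qed.

Let abs_below : bounded_below T -> bounded_below A.
Proof. by move=> [c c0 hc]; exists c => // x; rewrite nA. Qed.

(** The lower bound passes from [T] to [A], and to [S] by |A x| = |S S x| <= M |S x|; as [A] is
    onto, [U] is isometric everywhere. *)
Lemma power_mean_coercive_of_below : bounded_below T ->
  exists2 k, 0 < k & forall x, k * rnorm x ^+ 2 <= rdot (P x) (U x).
Proof.
move=> below; have [bA _] := pA; have [bS _] := pS.
have belowA := abs_below below.
have surjA := symmetric_surjective bA (positive_op_sym pA) belowA.
have belowS : bounded_below S.
  have [c c0 hc] := belowA; have /bounded_opP[_ [M M0 hM]] := bS.
  have M1 : 0 < M + 1 by rewrite ltr_wpDl.
  exists (c / (M + 1)) => [|x]; first exact: divr_gt0.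
  rewrite mulrAC ler_pdivrMr // (le_trans (hc x)) // -SS mulrC.
  by apply: le_trans (hM _) _; rewrite ler_wpM2r ?rnorm_ge0 // lerDl.
have nU y : rnorm (U y) = rnorm y by have [x <-] := surjA y; rewrite UA nA.
have [l0 l1] := andP hlambda.
have [|k k0 hk] := power_mean_coercive (a := 1 - lambda) _ l0 pS belowS (proj1 bU) nU.
  by rewrite subr_gt0.
by exists k => // x; have := hk x; rewrite !SS UA.
Qed.

Lemma invertible_power_mean : invertible_op T -> invertible_op P.
Proof.
move=> /(invertible_opP bT)[below surj].
have [k k0 hk] := power_mean_coercive_of_below below.
have [bA _] := pA.
have surjA := symmetric_surjective bA (positive_op_sym pA) (abs_below below).
have nU y : rnorm (U y) = rnorm y by have [x <-] := surjA y; rewrite UA nA.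
have belowP : bounded_below P.
  exists k => // x; have [->|x0] := eqVneq x 0; first by rewrite rnorm0 mulr0 rnorm_ge0.
  have n0 : 0 < rnorm x.
    by rewrite lt_def rnorm_ge0 andbT; apply: contra_neq x0; exact: rnorm_eq0.
  rewrite -(ler_pM2r n0) -mulrA -expr2 (le_trans (hk x)) //.
  by rewrite -[X in _ * X]nU rdot_CS.
apply/(invertible_opP bP); split=> //; apply: dense_range_surjective => // y oy.
(* Since y = T z = U (A z), coercivity at A z gives k |A z|^2 <= <P (A z), y> = 0. *)
have [z zy] := surj y; rewrite -zy -UA in oy *.
have := hk (A z); rewrite oy pmulr_rle0 // => h.
by rewrite (_ : A z = 0) ?linear_map0 //; [case: bU |
  apply/rnorm_eq0/eqP; rewrite -sqrf_eq0 eq_le h sqr_ge0].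
Qed.

(** [U], [A] and [S] all vanish on the kernel of [T], the last because |S x|^2 = <x, A x>. *)
Lemma power_mean_kernel x : T x = 0 -> P x = 0.
Proof.
move=> Tx; have [_ kU _] := polar_partP bT.
have Ux : U x = 0 by have : Defs.kernel T x by []; rewrite -kU.
have Ax : A x = 0 by apply: rnorm_eq0; rewrite nA Tx rnorm0.
have Sx : S x = 0.
  by apply/rnorm_eq0/eqP; rewrite -sqrf_eq0 -rdotxx positive_op_sym // SS Ax rdotC rdot0l.
rewrite /P /power_mean /duggal /aluthge /= -/A -/S -/U Tx Ux Sx.
rewrite (linear_map0 lA) (linear_map0 (proj1 bU)) (linear_map0 (T := S)) ?scaler0 ?addr0 //.
by case: pS => -[].
Qed.

(** The range of [A] is dense, as [A] is symmetric with zero kernel, and closed, as the isometry A x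
    -> T x carries it onto the closed range of [T]. *)
Lemma abs_surjective : (forall x, T x = 0 -> x = 0) -> closed (range T) ->
  forall y, exists x, A x = y.
Proof.
move=> injT clT y.
have [p ap op] := orthogonal_projection y (range_subspace lA).
have yp : y = p.
  apply/eqP; rewrite -subr_eq0; apply/eqP/injT/rnorm_eq0.
  rewrite -nA (symmetric_kernel (positive_op_sym pA)) ?rnorm0 // => x.
  by rewrite op //; exists x.
rewrite -{}yp in ap.
have [l al hl] := isometric_extension lA lT nA ap.
have [x0 _ Tx0] := closed_adherent clT al; exists x0.
apply/eqP; rewrite -subr_eq0; apply/eqP/rnorm_eq0/eqP.
rewrite eq_le rnorm_ge0 andbT; apply: (@ge0_le_eps _ _ 2) => // e e0.
have [_ [x _ <-] hx] := ap e e0.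
have := hl x; rewrite -Tx0 -linear_mapB // -nA linear_mapB // => h.
by have := rnormB_trans (A x) (A x0) y; rewrite (rnormBC (A x0) (A x)); lra.
Qed.

Lemma power_mean_invertible : invertible_op P -> closed (range T) -> invertible_op T.
Proof.
move=> /(invertible_opP bP)[belowP surjP] clT.
have injT x : T x = 0 -> x = 0.
  by move=> /power_mean_kernel; exact: bounded_below_inj.
have surjA := abs_surjective injT clT.
have [c c0 hc] := symmetric_surjective_below lA (positive_op_sym pA) surjA.
have below : bounded_below T by exists c => // x; rewrite -nA.
have [k k0 hk] := power_mean_coercive_of_below below.
apply/(invertible_opP bT); split=> //; apply: dense_range_surjective => // y oy.
(* With y = P z and z = A w, the vector U z = T w is orthogonal to [y]. *)
have [z zy] := surjP y; have [w wz] := surjA z.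
have := hk z; rewrite zy -wz UA rdotC oy pmulr_rle0 // => h.
have z0 : z = 0 by apply/rnorm_eq0/eqP; rewrite -sqrf_eq0 eq_le -wz h sqr_ge0.
by rewrite -zy z0 linear_map0 //; case: bP.
Qed.

End PowerMean.

End Invertibility.

Theorem theorem2p5 (R : realType) (H : hilbertType R) (lambda : R)
    (hlambda : 0 < lambda < 1) (T : H -> H) (hT : bounded_op T) :
  invertible_op T <->
  invertible_op (power_mean lambda T) /\ closed (range T).
Proof.
split=> [iT|[iP clT]]; last exact: power_mean_invertible iP clT.
split; first exact: invertible_power_mean.
have [_ surj] := proj1 (invertible_opP hT) iT.
rewrite (_ : range T = setT); first exact: closedT.
by apply/seteqP; split=> // y _; have [x <-] := surj y; exists x.
Qed.
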